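(* Let $p>5$ be a prime, let $m>n>0$ be integers, and let $a\in\mathbb{F}_p^*$. If $f:=x^m+ax^n$ permutes $\mathbb{F}_p$ (i.e. the map $c\mapsto f(c)$ is a bijection of $\mathbb{F}_p$), then $\gcd(m-n,p-1)\notin\{2,4\}$. *)

(* Defs.v *)
From mathcomp Require Import all_boot all_order all_algebra.

Set Implicit Arguments.
Unset Strict Implicit.
Unset Printing Implicit Defensive.

Import GRing.Theory.
Local Open Scope ring_scope.

Definition permutes (F : finFieldType) (f : {poly F}) : Prop :=
  bijective (fun c : F => f.[c]).

(* Main.v *)
Require Import Defs.
From mathcomp Require Import all_boot all_order all_algebra.
From mathcomp Require Import finfield ring zify.

Set Implicit Arguments.
Unset Strict Implicit.
Unset Printing Implicit Defensive.

Import GRing.Theory.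
Local Open Scope ring_scope.

(** Hermite's criterion.  Write [d = gcd(m - n, p - 1)], [p - 1 = d * k] and
    [m - n = d * s].  If [f] permutes [F_p] then its [j]-th power sum vanishes
    for [0 < j < p - 1]; when [j = d * T], expanding it leaves the terms
    [C(j, i) a^(j - i)] with [0 <= i <= j] and [i] in a fixed residue class
    modulo [k].  No such term is zero in [F_p], so the class never meets
    [[0, j]] exactly once.  Taking [j] to be the multiple of [d] near [k] leaves
    at most two terms: for [d = 2] there is exactly one, and for [d = 4] two
    terms force [a^k] to be one of [-3/4], [-4/3], [-21/32], [-32/21], or [-1].
    As [a^(4k) = 1], each of the first four makes [p] divide
    [4^4 - 3^4 = 5^2 * 7] or [32^4 - 21^4 = 5 * 11 * 53 * 293], which the class
    of [p] modulo 16 forbids; the last is excluded by [j = 8]. *)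

(** * Power sums over the prime field *)

Lemma Fp_expr_pred (p : nat) (x : 'F_p) :
  prime p -> x != 0 -> x ^+ (p - 1) = 1.
Proof.
move=> p_prime x_neq0; apply: (mulfI x_neq0).
rewrite -exprS subn1 prednK ?prime_gt0 // mulr1.
by have := expf_card x; rewrite card_Fp.
Qed.

Lemma Fp_natr_eq0 (p c : nat) : prime p -> (c%:R == 0 :> 'F_p) = (p %| c)%N.
Proof. by move=> p_prime; rewrite -(dvdn_pcharf (pchar_Fp p_prime)). Qed.

Lemma Fp_bin_neq0 (p j i : nat) :
  prime p -> (j < p)%N -> (i <= j)%N -> 'C(j, i)%:R != 0 :> 'F_p.
Proof.
move=> p_prime lt_jp le_ij; rewrite Fp_natr_eq0 //.
apply/negP => p_bin.
have : (p %| j`!)%N by rewrite -(bin_fact le_ij) dvdn_mulr.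
by rewrite fact_prod big_add1 /= big_mkord Euclid_dvd_prod // big_has;
  case/hasP => t _ /dvdn_leq; have := ltn_ord t; lia.
Qed.

(** If [p - 1] divides [j], the [p - 1] nonzero terms all equal 1. Otherwise some nonzero [c] has
    [c ^+ j != 1], and substituting [c * x] for [x] multiplies the sum by [c ^+ j], so it
    vanishes. *)
Lemma Fp_sum_expr (p j : nat) : prime p -> (0 < j)%N ->
  \sum_(x : 'F_p) x ^+ j = if (p - 1 %| j)%N then -1 else 0.
Proof.
move=> p_prime j_gt0; have p_gt1 := prime_gt1 p_prime.
case: ifPn => [dvd_j | ndvd_j].
  rewrite (bigD1 0) //= expr0n eqn0Ngt j_gt0 add0r.
  transitivity (\sum_(x : 'F_p | x != 0) (1 : 'F_p)).
    apply: eq_bigr => x x_neq0; case/dvdnP: dvd_j => q ->.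
    by rewrite mulnC exprM Fp_expr_pred // expr1n.
  rewrite sumr_const cardC1 card_Fp // -subn1 natrB ?prime_gt0 //.
  by rewrite pchar_Fp_0 // sub0r.
have [c c_neq0 c_j] : exists2 c : 'F_p, c != 0 & c ^+ j != 1.
  pose r := (j %% (p - 1))%N.
  have r_gt0 : (0 < r)%N by rewrite lt0n.
  have r_lt : (r < p - 1)%N by rewrite ltn_mod; lia.
  have exp_r (x : 'F_p) : x != 0 -> x ^+ j = x ^+ r.
    by move=> x_neq0; rewrite /r expr_mod // Fp_expr_pred.
  (* Otherwise [X^r - 1] would have all [p - 1 > r] nonzero elements as roots. *)
  apply/exists_inP; apply: contraLR r_lt => /exists_inPn all1.
  rewrite -leqNgt.
  have -> : (p - 1 = size (enum (predC1 (0%R : 'F_p))))%N.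
    by rewrite -cardE cardC1 card_Fp // subn1.
  apply: max_unity_roots r_gt0 _ (enum_uniq _); apply/allP => x.
  rewrite mem_enum => x_neq0; apply/unity_rootP.
  by have := all1 x x_neq0; rewrite negbK exp_r // => /eqP.
pose S := \sum_(x : 'F_p) x ^+ j.
have : c ^+ j * S = S.
  rewrite mulr_sumr [RHS](reindex_inj (mulfI c_neq0)) /=.
  by apply: eq_bigr => x _; rewrite exprMn.
move/eqP; rewrite -subr_eq0 -{2}[S]mul1r -mulrBl mulf_eq0 subr_eq0.
by rewrite (negPf c_j) => /eqP.
Qed.

(** Since [f] permutes the field, the sum of [f(x)^j = x^(n j) (a + x^e)^j] over [x] is zero. In its
    expansion only exponents divisible by [p - 1] survive, each contributing a power sum of -1. *)
Lemma permutes_binomial_sum (p n e j : nat) (a : 'F_p) :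
  prime p -> (0 < n)%N -> permutes ('X^(n + e) + a *: 'X^n) ->
  (0 < j < p - 1)%N ->
  \sum_(i < j.+1 | (p - 1 %| n * j + e * i)%N)
     'C(j, i)%:R * a ^+ (j - i) = 0.
Proof.
move=> p_prime n_gt0 perm_f /andP[j_gt0 j_lt].
have : \sum_(x : 'F_p) x ^+ j = 0.
  rewrite Fp_sum_expr //; case: ifP => // /dvdn_leq; lia.
rewrite (reindex_inj (bij_inj perm_f)) /=.
under eq_bigr => x _.
  have -> : ('X^(n + e) + a *: 'X^n).[x] ^+ j =
     \sum_(i < j.+1) 'C(j, i)%:R * a ^+ (j - i) * x ^+ (n * j + e * i).
    have -> : ('X^(n + e) + a *: 'X^n).[x] = x ^+ n * (a + x ^+ e).
      by rewrite !hornerE exprD; ring.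
    rewrite exprMn exprDn mulr_sumr; apply: eq_bigr => i _.
    by rewrite exprD !exprM -mulr_natl; ring.
  over.
rewrite exchange_big /=.
under eq_bigr => i _ do rewrite -mulr_sumr Fp_sum_expr ?addn_gt0 ?muln_gt0 ?n_gt0 ?j_gt0 //.
move=> sum0; apply: oppr_inj; rewrite oppr0 -[RHS]sum0 -sumrN big_mkcond /=.
by apply: eq_bigr => i _; case: ifP => _; rewrite ?mulrN1 ?mulr0.
Qed.

(** * Sums over residue classes modulo [k] *)

Lemma dvdn_shift (k M r i : nat) :
  (k %| M + r)%N -> (k %| M + i)%N = (i == r %[mod k]).
Proof.
by rewrite {1}/dvdn => /eqP Mr; rewrite -(eqn_modDl M) Mr.
Qed.

Lemma sum_residue1 (V : nmodType) (G : nat -> V) (k M r j : nat) :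
  (r < k)%N -> (k %| M + r)%N -> (r <= j < r + k)%N ->
  \sum_(i < j.+1 | (k %| M + i)%N) G i = G r.
Proof.
move=> r_lt dvd_r /andP[le_rj lt_j].
rewrite (bigD1 (inord r)) /= ?inordK ?ltnS // big1 ?addr0 // => i.
case/andP; rewrite (dvdn_shift _ dvd_r) => /eqP eq_i /eqP neq_i.
case: neq_i; apply: val_inj; rewrite /= inordK ?ltnS //.
have := divn_eq i k; rewrite eq_i (modn_small r_lt); have := ltn_ord i.
by case: (i %/ k)%N => [|q]; rewrite ?mulSn; lia.
Qed.

Lemma sum_residue2 (V : nmodType) (G : nat -> V) (k M r j : nat) :
  (r < k)%N -> (k %| M + r)%N -> (r + k <= j < r + k + k)%N ->
  \sum_(i < j.+1 | (k %| M + i)%N) G i = G r + G (r + k)%N.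
Proof.
move=> r_lt dvd_r /andP[le_rj lt_j].
have le_r : (r <= j)%N by lia.
have dvd_rk : (k %| M + (r + k))%N by rewrite addnA dvdn_addl.
rewrite (bigD1 (inord r)) /= ?inordK ?ltnS //; congr (_ + _).
rewrite (bigD1 (inord (r + k))) /= ?inordK ?ltnS //; last first.
  by rewrite dvd_rk -val_eqE /= !inordK ?ltnS //; lia.
rewrite big1 ?addr0 // => i.
case/andP=> /andP[]; rewrite (dvdn_shift _ dvd_r) => /eqP eq_i.
rewrite -!val_eqE /= !inordK ?ltnS //.
have := divn_eq i k; rewrite eq_i (modn_small r_lt); have := ltn_ord i.
by case: (i %/ k)%N => [|[|q]]; rewrite ?mulSn; lia.
Qed.

Lemma residue_exists (k M : nat) :
  (0 < k)%N -> exists2 r, (r < k)%N & (k %| M + r)%N.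
Proof.
move=> k_gt0; exists ((k - M %% k) %% k)%N; first by rewrite ltn_mod.
rewrite /dvdn modnDmr -modnDml subnKC ?modnn //.
by rewrite ltnW // ltn_mod.
Qed.

(* [N] stands for [n / s] modulo [k], where [m - n = d * s] and
   [p - 1 = d * k]; the sum is, up to sign, the power sum of [f] of order
   [d * T]. *)
Definition hermite_sums (p d k N : nat) (a : 'F_p) : Prop :=
  forall T, (0 < T < k)%N ->
  \sum_(i < (d * T).+1 | (k %| N * T + i)%N)
     'C(d * T, i)%:R * a ^+ (d * T - i) = 0.

(** Take [N = n * u] with [u] inverse to [s] modulo [k]: then [n * T + s * i] is congruent to
    [s * (N * T + i)], and [s] cancels. *)
Lemma permutes_hermite_sums (p n s d k : nat) (a : 'F_p) :
  prime p -> (0 < n)%N -> (0 < s)%N -> (0 < d)%N -> p = (d * k).+1 ->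
  coprime s k -> permutes ('X^(n + d * s) + a *: 'X^n) ->
  exists2 N, n = N * s %[mod k] & hermite_sums d k N a.
Proof.
move=> p_prime n_gt0 s_gt0 d_gt0 def_p co_sk perm_f.
case: (egcdnP k s_gt0) => u v; rewrite (eqP co_sk) => def_u _.
have def_n : n = (n * u) * s %[mod k].
  by rewrite -mulnA def_u mulnDr mulnA modnMDl muln1.
exists (n * u)%N => // T /andP[T_gt0 T_lt].
have dT : (0 < d * T < p - 1)%N by rewrite def_p subn1 /= muln_gt0 d_gt0 T_gt0 ltn_pmul2l.
rewrite -[RHS](permutes_binomial_sum p_prime n_gt0 perm_f dT).
apply: eq_bigl => i; rewrite def_p subn1 /=.
have -> : (n * (d * T) + d * s * i = d * (n * T + s * i))%N by ring.
rewrite dvdn_pmul2l //.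
have -> : (k %| n * T + s * i = (k %| s * (n * u * T + i)))%N.
  have -> : (s * (n * u * T + i) = n * u * s * T + s * i)%N by ring.
  by rewrite /dvdn -(modnDml (n * T)) -(modnMml n) def_n modnMml modnDml.
by rewrite Gauss_dvdr // coprime_sym.
Qed.

(** Otherwise [r] would be the only index of the sum, and its term is nonzero because
    [d * T < p]. *)
Lemma hermite_sums_residue (p d k N T r : nat) (a : 'F_p) :
  prime p -> p = (d * k).+1 -> a != 0 -> hermite_sums d k N a ->
  (0 < T < k)%N -> (r < k)%N -> (k %| N * T + r)%N ->
  (r <= d * T)%N -> (r + k <= d * T)%N.
Proof.
move=> p_prime def_p a_neq0 sums0 T_int r_lt dvd_r le_r.
rewrite leqNgt; apply/negP => lt_dT.
have := sums0 T T_int.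
rewrite (sum_residue1 (fun i => 'C(d * T, i)%:R * a ^+ (d * T - i)) r_lt dvd_r).
  move/eqP; rewrite mulf_eq0 expf_eq0 (negPf a_neq0) andbF orbF.
  by apply/negP; rewrite Fp_bin_neq0 // def_p; nia.
by rewrite le_r.
Qed.

(** * The cases [d = 2] and [d = 4] *)

Lemma hermite_sums2 (p k N : nat) (a : 'F_p) :
  prime p -> p = (2 * k).+1 -> (2 < k)%N -> a != 0 ->
  (~~ odd k -> odd N) -> ~ hermite_sums 2 k N a.
Proof.
move=> p_prime def_p k_gt2 a_neq0 oddN sums0.
have k_gt0 : (0 < k)%N by lia.
(* For [T = uphalf k.-1], [2 * T] is [k - 1] or [k] according as [k] is odd or even, so
   [r <= 2 * T]. Then [r + k <= 2 * T] leaves only [k] even and [r = 0], which would make [N]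
   even. *)
have [r r_lt dvd_r] := residue_exists (N * uphalf k.-1) k_gt0.
have := hermite_sums_residue p_prime def_p a_neq0 sums0 _ r_lt dvd_r.
case: (boolP (odd k)) => [odd_k | even_k]; first by lia.
have {}oddN := oddN even_k.
suff : r != 0%N by lia.
apply: contraTneq dvd_r => ->; rewrite addn0.
have {1}-> : (k = 2 * uphalf k.-1)%N by lia.
by rewrite dvdn_pmul2r ?dvdn2 ?oddN; lia.
Qed.

Lemma hermite_sums4 (p k N : nat) (a : 'F_p) :
  prime p -> p = (4 * k).+1 -> (2 < k)%N -> a != 0 ->
  (~~ odd k -> odd N) -> ~ hermite_sums 4 k N a.
Proof.
move=> p_prime def_p k_gt2 a_neq0 oddN sums0.
have k_gt0 : (0 < k)%N by lia.
have a4k : a ^+ k ^+ 4 = 1.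
  have := Fp_expr_pred p_prime a_neq0.
  by have -> : (p - 1 = k * 4)%N by [lia]; rewrite exprM.
have k4 : 4 * k%:R = -1 :> 'F_p.
  have : (4 * k + 1)%:R = 0 :> 'F_p by rewrite addn1 -def_p pchar_Fp_0.
  by rewrite natrD natrM => /eqP; rewrite addr_eq0 => /eqP.
have pow4 (u v : 'F_p) : v * a ^+ k = u -> v ^+ 4 - u ^+ 4 = 0.
  by move<-; rewrite exprMn a4k mulr1 subrr.
have residue := hermite_sums_residue p_prime def_p a_neq0 sums0.
(* This choice puts [4 * T] between [k - 1] and [k + 2], so [r <= 4 * T] is automatic and
   [r + k <= 4 * T] leaves [r <= 2]. *)
pose T := ((k + 2) %/ 4)%N.
have T_bound : (k <= 4 * T + 1 <= k + 3)%N by rewrite /T; lia.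
have T_int : (0 < T < k)%N by lia.
have [r r_lt dvd_r] := residue_exists (N * T) k_gt0.
have le_r : (r + k <= 4 * T)%N.
  by apply: (residue _ _ T_int r_lt dvd_r); lia.
have sum2 := sums0 T T_int.
rewrite (sum_residue2 (fun i => 'C(4 * T, i)%:R * a ^+ (4 * T - i)) r_lt dvd_r)
  in sum2; last by rewrite le_r; lia.
have [[def_k r0] | [[def_k lt_r2] | [def_k lt_r3]]] :
  (k = 4 * T /\ r = 0 \/ (k = 4 * T - 1 /\ (r < 2) \/
   k = 4 * T - 2 /\ (r < 3)))%N by lia.
- have odd_N : odd N by apply: oddN; lia.
  have : (4 %| N)%N.
    by move: dvd_r; rewrite r0 addn0 {1}def_k dvdn_pmul2r //; lia.
  lia.
- have def_4T : (4 * T = k.+1)%N by lia.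
  (* Here [p = 16 * T - 3] is 13 modulo 16, hence neither 5 nor 7. *)
  have no_root : 4 ^+ 4 - 3 ^+ 4 = 0 :> 'F_p -> False.
    have -> : 4 ^+ 4 - 3 ^+ 4 = 5 * 5 * 7 :> 'F_p by ring.
    move/eqP; rewrite !mulf_eq0 !Fp_natr_eq0 // !dvdn_prime2 //.
    by lia.
  case: r lt_r2 {r_lt dvd_r le_r} sum2 => [|[|//]] _; rewrite def_4T.
    rewrite add0n bin0 binSn subn0 subSnn expr1 exprSr -[k.+1%:R]natr1 => /eqP.
    rewrite mul1r -mulrDl mulf_eq0 (negPf a_neq0) orbF => /eqP sum2.
    apply: no_root; rewrite -(pow4 (-3) 4); first by ring.
    have -> : 4 * a ^+ k = 4 * (a ^+ k + (k%:R + 1)) - 4 * k%:R - 4 by ring.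
    by rewrite sum2 k4; ring.
  rewrite add1n bin1 binn subn1 subnn /= mul1r expr0 -[k.+1%:R]natr1 => sum2.
  apply: no_root; rewrite -[LHS]opprK -[RHS]oppr0 -(pow4 (-4) 3); first by ring.
  have -> : 3 * a ^+ k = 4 * ((k%:R + 1) * a ^+ k + 1)
                         - (4 * k%:R + 1) * a ^+ k - 4 by ring.
  by rewrite sum2 k4; ring.
- have def_4T : (4 * T = k.+2)%N by lia.
  (* As [4 * k = -1], the product [(4 * k + 8) * (4 * k + 4)] is [7 * 3]. *)
  have bin_k : 32 * 'C(k.+2, 2)%:R = 21 :> 'F_p.
    have : ('C(k.+2, 2) * 2 = k.+2 * k.+1)%N.
      by have := bin_ffact k.+2 2; rewrite !ffactnS ffactn0 muln1.
    move/(congr1 (fun c => c%:R : 'F_p)); rewrite !natrM -[k.+2%:R]natr1 -[k.+1%:R]natr1 => bin_k.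
    have -> : 32 * 'C(k.+2, 2)%:R = 16 * ('C(k.+2, 2)%:R * 2) :> 'F_p by ring.
    have -> : 21 = (-1 + 8) * (-1 + 4) :> 'F_p by ring.
    by rewrite bin_k -k4; ring.
  (* Here [p = 16 * T - 7] is 9 modulo 16, while 5, 53 and 293 are 5 and 11 is 11. *)
  have no_root : 32 ^+ 4 - 21 ^+ 4 = 0 :> 'F_p -> False.
    have -> : 32 ^+ 4 - 21 ^+ 4 = 11 * 53 * 5 * 293 :> 'F_p by ring.
    move/eqP; rewrite 3!mulf_eq0 4!(Fp_natr_eq0 _ p_prime).
    by rewrite !(dvdn_prime2 p_prime); [lia | vm_compute ..].
  case: r lt_r3 r_lt dvd_r {le_r} sum2 => [|[|[|//]]] _ r_lt dvd_r; rewrite def_4T.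
  + rewrite add0n bin0 subn0 -(bin_sub (leqW (leqnSn k))) -{1}addn2 exprD.
    have -> : (k.+2 - k = 2)%N by lia.
    rewrite mul1r -mulrDl => /eqP.
    rewrite mulf_eq0 expf_eq0 (negPf a_neq0) orbF => /eqP sum2.
    apply: no_root; rewrite -(pow4 (- 21) 32); first by ring.
    have -> : 32 * a ^+ k = 32 * (a ^+ k + 'C(k.+2, 2)%:R) - 32 * 'C(k.+2, 2)%:R by ring.
    by rewrite sum2 bin_k; ring.
  (* Here the relation only says [a^k = -1], so [j = 8] is used instead. *)
  + move=> _; have k_gt4 : (4 < k)%N by lia.
    (* Multiply [N * T + 1] by 4 and use [4 * T = k + 2]. The residue 4 for [T = 2] would then
       require [4 + k <= 8]. *)
    have dvd_4 : (k %| N * 2 + 4)%N.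
      have : (k %| 4 * (N * T + 1))%N by rewrite dvdn_mull.
      have -> : (4 * (N * T + 1) = N * k + (N * 2 + 4))%N by nia.
      by rewrite dvdn_addr ?dvdn_mull.
    have := residue 2%N 4%N _ k_gt4 dvd_4; lia.
  + rewrite add2n binn subnn expr0 mulr1.
    have -> : (k.+2 - 2 = k)%N by lia.
    move=> sum2; apply: no_root; rewrite -[LHS]opprK -[RHS]oppr0.
    rewrite -(pow4 (- 32) 21); first by ring.
    have -> : 21 * a ^+ k = 32 * ('C(k.+2, 2)%:R * a ^+ k + 1) - 32.
      by rewrite -bin_k; ring.
    by rewrite sum2; ring.
Qed.

Theorem theorem1p1 (p : nat) (p_prime : prime p) (p_gt5 : (5 < p)%N)
    (m n : nat) (n_gt0 : (0 < n)%N) (n_lt_m : (n < m)%N)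
    (a : 'F_p) (a_neq0 : a != 0)
    (f_perm : permutes ('X^m + a *: 'X^n : {poly 'F_p})) :
  gcdn (m - n) (p - 1) \notin [:: 2%N; 4%N].
Proof.
set d := gcdn (m - n) (p - 1); apply/negP => d24.
have d_gt0 : (0 < d)%N by rewrite gcdn_gt0 subn_gt0 n_lt_m.
have /dvdnP[s def_s] : (d %| m - n)%N := dvdn_gcdl _ _.
have /dvdnP[k def_k] : (d %| p - 1)%N := dvdn_gcdr _ _.
have co_sk : coprime s k.
  by rewrite /coprime -(eqn_pmul2r d_gt0) muln_gcdl -def_s -def_k mul1n.
have def_m : m = (n + d * s)%N by rewrite mulnC -def_s subnKC // ltnW.
have def_p : p = (d * k).+1 by rewrite mulnC -def_k subn1 prednK ?prime_gt0.
have odd_p : odd p by case: (even_prime p_prime) => // p2; move: p_gt5; rewrite p2.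
have even_d : ~~ odd d by move: d24; rewrite !inE => /orP[] /eqP ->.
(* If [n] were even, so would be [m], and [f] would agree at 1 and -1. *)
have odd_n : odd n.
  apply: contraT => even_n; have /bij_inj/(_ 1 (-1)) := f_perm.
  have even_m : ~~ odd m by rewrite def_m oddD oddM (negPf even_n) (negPf even_d).
  rewrite !(hornerD, hornerZ, hornerXn) -[_ ^+ m in RHS]signr_odd.
  rewrite -[_ ^+ n in RHS]signr_odd (negPf even_m) (negPf even_n) !expr1n.
  move=> /(_ erefl)/eqP.
  by rewrite -subr_eq0 opprK -mulr2n Fp_natr_eq0 // => /dvdn_leq; lia.
have s_gt0 : (0 < s)%N by case: (posnP s) => // s0; lia.
have perm_f : permutes ('X^(n + d * s) + a *: 'X^n) by rewrite -def_m.
have [N def_N sums0] :=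
  permutes_hermite_sums p_prime n_gt0 s_gt0 d_gt0 def_p co_sk perm_f.
have oddN : ~~ odd k -> odd N.
  move=> even_k; have k2 : (2 %| k)%N by rewrite dvdn2.
  have := congr1 (modn^~ 2) def_N.
  by rewrite /= !modn_dvdm // !modn2 odd_n oddM; case: (odd N).
rewrite !inE in d24; case/orP: d24 => /eqP def_d; rewrite def_d in def_p sums0.
- by apply: hermite_sums2 p_prime def_p _ a_neq0 oddN sums0; lia.
(* The value [k = 2] would give [p = 9]. *)
- have k_neq2 : k != 2 by apply: contraTneq (p_prime) => k2; rewrite def_p k2.
  by apply: hermite_sums4 p_prime def_p _ a_neq0 oddN sums0; lia.
Qed.
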